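(* Let $k\ge 3$ be an integer. If $\Gamma\in\{HS(2k,k),\,FHS(2k,k)\}$, then $\Gamma$ is not a Cayley graph (i.e. $\Gamma$ is not isomorphic to any Cayley graph).
   Context: Hyper-star graph: let $X=\{1,2,\dots,2k\}$. The graph $HS(2k,k)$ is the simple undirected graph whose vertex-set is the set of all $k$-element subsets of $X$, where two vertices $v,w$ are adjacent if and only if $|v\cap w|=k-1$ and the element $1$ belongs to exactly one of $v$ and $w$. Folded hyper-star graph: $FHS(2k,k)$ is the graph with the same vertex-set $V_1$ as $HS(2k,k)$ and with edge-set $E_1\cup\{\{v,v^c\}\mid v\in V_1\}$, where $E_1$ is the edge-set of $HS(2k,k)$ and $v^c=X\setminus v$ is the complement of $v$ in $X$. Cayley graph: let $G$ be a finite group with identity $1$ and let $\Omega$ be a set of generators of $G$ such that $x\in\Omega$ implies $x^{-1}\in\Omega$, and $1\notin\Omega$. The Cayley graph $\Gamma(G,\Omega)$ is the simple graph with vertex-set $G$ and edge-set $\{\{g,h\}\mid g^{-1}h\in\Omega\}$. *)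

(* Defs.v *)
From mathcomp Require Import all_boot all_fingroup.

Set Implicit Arguments.
Unset Strict Implicit.
Unset Printing Implicit Defensive.

Import GroupScope.

(* A finite simple graph is a symmetric irreflexive relation on a finType;
   these properties are proved below for each of the graphs defined here. *)

Definition graph_iso (T U : finType) (e : rel T) (f : rel U) : Prop :=
  exists2 phi : T -> U, bijective phi & forall x y, f (phi x) (phi y) = e x y.

(* The set {1, ..., 2k} is encoded by 'I_(2 * k), where i stands for i + 1. *)
Notation ksubset k := {v : {set 'I_(2 * k)%N} | #|v| == k%N}.

(* The element 1 of {1, ..., 2k} is the ordinal of value 0. *)
Definition has_one (k : nat) (v : ksubset k) : bool :=
  [exists i in val v, val i == 0%N].

Definition HS (k : nat) : rel (ksubset k) :=
  fun v w => (#|val v :&: val w| == k.-1) && (has_one v (+) has_one w).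

Definition FHS (k : nat) : rel (ksubset k) :=
  fun v w => HS v w || (val w == ~: val v).

Definition connection_set (gT : finGroupType) (Omega : {set gT}) : Prop :=
  [/\ <<Omega>> = [set: gT],
      forall x, x \in Omega -> x^-1 \in Omega
    & 1 \notin Omega].

Definition cayley (gT : finGroupType) (Omega : {set gT}) : rel gT :=
  fun g h => g^-1 * h \in Omega.

Definition is_cayley_graph (T : finType) (e : rel T) : Prop :=
  exists (gT : finGroupType) (Omega : {set gT}),
    connection_set Omega /\ graph_iso e (cayley Omega).

Lemma HS_sym k : symmetric (@HS k).
Proof. by move=> v w; rewrite /HS setIC addbC. Qed.

Lemma HS_irr k : irreflexive (@HS k).
Proof. by move=> v; rewrite /HS addbb andbF. Qed.

Lemma FHS_sym k : symmetric (@FHS k).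
Proof.
move=> v w; rewrite /FHS HS_sym; congr (_ || _).
by apply/eqP/eqP => ->; rewrite setCK.
Qed.

Lemma FHS_irr k : 0 < k -> irreflexive (@FHS k).
Proof.
move=> k_gt0 v; rewrite /FHS HS_irr /=; apply/negP => /eqP vC.
have v0 : val v = set0 by rewrite -(setICr (val v)) -vC setIid.
by have := valP v; rewrite v0 cards0 eq_sym; case: k k_gt0 v vC v0.
Qed.

Lemma cayley_sym (gT : finGroupType) (Omega : {set gT}) :
  connection_set Omega -> symmetric (cayley Omega).
Proof.
case=> _ OmegaV _ g h; rewrite /cayley.
by apply/idP/idP => /OmegaV; rewrite invMg invgK.
Qed.

Lemma cayley_irr (gT : finGroupType) (Omega : {set gT}) :
  connection_set Omega -> irreflexive (cayley Omega).
Proof. by case=> _ _ Omega1 g; rewrite /cayley mulVg (negbTE Omega1). Qed.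

(* Main.v *)
Require Import Defs.
From mathcomp Require Import all_boot all_fingroup.
From mathcomp Require Import ssralg ssrnum ssrint order cyclic zify.

Set Implicit Arguments.
Unset Strict Implicit.
Unset Printing Implicit Defensive.

(** Put m = k - 1 and D = X \ {1}, a set of 2m + 1 points.  A vertex v is
determined by its side (whether 1 is in v) and its core, the m-subset v \ {1}
or v^c \ {1} of D.  In these terms two vertices are adjacent in HS when their
sides differ and their cores are disjoint, and FHS adds the edges between
vertices of different sides with the same core.  In both graphs two distinct
vertices have exactly one common neighbour precisely when they have the same
side and their cores share m - 1 points ([johnson_common_neighbour]).  So every
automorphism of either graph preserves this relation, which is two disjoint
copies of the Johnson graph J(2m + 1, m), and it suffices to show that no group
acts regularly on the vertices while preserving it; a Cayley graph carries such
an action, by left translations.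

For A in D of size m - 1, the vertices of a given side whose core contains A
form a clique of size m + 2, called a star, and every clique of this size is a
star ([johnson_clique_star]); the group therefore permutes the stars.  Being
transitive on vertices, it is transitive on stars: the sums of f(B \ x) over x
in B, for all m-sets B, determine a function f on (m - 1)-sets
([inclusion_injective]), so that the indicator function of one orbit of stars,
having all its sums equal, is constant.  This is the argument of Livingstone
and Wagner.

A vertex lies on m stars and a star has m + 2 vertices; by regularity, if h is
the order of the stabiliser of a star, then m + 2 = h m.  As m >= 2, this forces
m = h = 2.  In that last case the involution g that stabilises a star S maps
another star T of the same side to a star of the same side.  Two distinct stars
of the same side meet in one vertex, so g fixes a vertex, in S and T if g
stabilises T, in T and its image otherwise.  This contradicts regularity. *)

(** * Functions on the subsets of fixed size of a finite set *)

Definition layer (X : finType) (D : {set X}) (t : nat) : {set {set X}} :=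
  [set A : {set X} | A \subset D & #|A| == t].

Section Inclusion.
Import GRing.Theory Num.Theory.
Local Open Scope ring_scope.
Variables (X : finType) (D : {set X}).

(** Both sides run over the pairs of a t-set and a (t+1)-set containing it. *)
Lemma sum_layerS (F : {set X} -> X -> int) t :
  \sum_(B in layer D t.+1) \sum_(y in B) F (B :\ y) y
    = \sum_(A in layer D t) \sum_(y in D :\: A) F A y.
Proof.
rewrite !pair_big_dep /=.
rewrite (reindex_onto (fun p : {set X} * X => (p.2 |: p.1, p.2))
                      (fun p : {set X} * X => (p.1 :\ p.2, p.2))) /=; last first.
  by move=> [B y] /= /andP [_ yB]; rewrite setD1K.
apply: eq_big => [[A y]|[A y]] /=.
  rewrite !inE !eqxx /= andbT subUset sub1set xpair_eqE eqxx andbT.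
  case: (boolP (y \in A)) => [yA|yA] /=.
    rewrite (setUidPr _) ?sub1set // andbF; apply/negP => /andP[_ /eqP E].
    by have := yA; rewrite -{1}E !inE eqxx.
  rewrite setU1K // eqxx andbT cardsU1 yA add1n eqSS.
  by rewrite -[LHS]andbA andbC.
move=> /andP[_ /eqP[E]].
by rewrite E.
Qed.

(** Expanding the squares, the products of f at two distinct (t+1)-sets are the
same on both sides: such sets have a (t+2)-set as union exactly when they have
a t-set as intersection.  The diagonal terms differ, since a (t+1)-set lies in
#|D| - (t+1) sets of size t+2 and contains t+1 sets of size t. *)
Lemma inclusion_identity (f : {set X} -> int) t :
  \sum_(B in layer D t.+2) (\sum_(x in B) f (B :\ x)) ^+ 2
    = \sum_(C in layer D t) (\sum_(x in D :\: C) f (x |: C)) ^+ 2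
      + \sum_(A in layer D t.+1) f A ^+ 2 * (#|D|%:Z - (t.+1).*2%:Z).
Proof.
pose cross (A : {set X}) := \sum_(x in A) \sum_(y in D :\: A) f A * f ((y |: A) :\ x).
have up : \sum_(B in layer D t.+2) (\sum_(x in B) f (B :\ x)) ^+ 2
    = \sum_(A in layer D t.+1) (f A ^+ 2 * (#|D|%:Z - t.+1%:Z) + cross A).
  transitivity (\sum_(B in layer D t.+2) \sum_(y in B)
      \sum_(x in y |: (B :\ y)) f (B :\ y) * f ((y |: (B :\ y)) :\ x)).
    apply: eq_bigr => B _; rewrite expr2 mulr_suml; apply: eq_bigr => y yB.
    by rewrite mulr_sumr setD1K.
  rewrite (sum_layerS (fun A y => \sum_(x in y |: A) f A * f ((y |: A) :\ x))).
  apply: eq_bigr => A; rewrite inE => /andP[AD /eqP cA].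
  transitivity (\sum_(y in D :\: A)
      (f A ^+ 2 + \sum_(x in A) f A * f ((y |: A) :\ x))).
    apply: eq_bigr => y; rewrite inE => /andP[yA _].
    by rewrite big_setU1 //= setU1K // expr2.
  rewrite big_split /= sumr_const /cross exchange_big /=; congr (_ + _).
  by rewrite cardsDS // cA -mulr_natr natrB ?natz // -cA subset_leq_card.
have down : \sum_(C in layer D t) (\sum_(x in D :\: C) f (x |: C)) ^+ 2
    = \sum_(A in layer D t.+1) (f A ^+ 2 * t.+1%:Z + cross A).
  transitivity (\sum_(C in layer D t) \sum_(y in D :\: C)
      \sum_(x in D :\: C) f (y |: C) * f (x |: C)).
    apply: eq_bigr => C _; rewrite expr2 mulr_suml; apply: eq_bigr => y _.
    by rewrite mulr_sumr.
  rewrite -(sum_layerS (fun C y => \sum_(x in D :\: C) f (y |: C) * f (x |: C))).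
  apply: eq_bigr => A; rewrite inE => /andP[AD /eqP cA].
  transitivity (\sum_(x in A)
      (f A ^+ 2 + \sum_(y in D :\: A) f A * f ((y |: A) :\ x))).
    apply: eq_bigr => x xA.
    have -> : D :\: (A :\ x) = x |: (D :\: A).
      rewrite setDDr (setIidPr _) ?sub1set ?(subsetP AD) //.
      by rewrite setUC.
    rewrite big_setU1 ?inE ?xA //= setD1K // expr2; congr (_ + _).
    apply: eq_bigr => y; rewrite inE => /andP[yA _]; congr (_ * f _).
    rewrite setDUl; congr (_ :|: _); apply/esym/setDidPl.
    by rewrite disjoints1 inE; apply: contraNneq yA => ->.
  by rewrite big_split /= sumr_const /cross cA -mulr_natr natz.
rewrite up down -big_split /=; apply: eq_bigr => A _.
rewrite addrAC -mulrDr; congr (_ * _ + _); lia.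
Qed.

(** Below the middle layer both terms on the right of [inclusion_identity] are
nonnegative, so they vanish with the left-hand side. *)
Lemma inclusion_injective (f : {set X} -> int) t :
  ((t.+1).*2 < #|D|)%N ->
  (forall B, B \in layer D t.+2 -> \sum_(x in B) f (B :\ x) = 0) ->
  forall A, A \in layer D t.+1 -> f A = 0.
Proof.
move=> tD f0 A AL; have := inclusion_identity f t.
rewrite big1 => [|B BL]; last by rewrite f0 // expr0n.
have d_gt0 : (0 : int) < #|D|%:Z - (t.+1).*2%:Z by lia.
move=> /esym/eqP; rewrite paddr_eq0; last 2 first.
- by apply: sumr_ge0 => C _; apply: sqr_ge0.
- by apply: sumr_ge0 => B _; rewrite mulr_ge0 ?sqr_ge0 // Order.POrderTheory.ltW.
case/andP=> _; rewrite psumr_eq0 => [/allP/(_ A)|B _]; last first.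
  by rewrite mulr_ge0 ?sqr_ge0 // Order.POrderTheory.ltW.
rewrite mem_index_enum => /(_ isT); rewrite AL /= mulf_eq0 sqrf_eq0.
by case/orP=> [/eqP //|/eqP]; lia.
Qed.
End Inclusion.
(** * Large cliques of the Johnson graph *)

Section Cliques.
Variables (X : finType) (r : nat).

(** If C misses a point of A :&: B, then by inclusion-exclusion at least
2r - (r-1) of its points lie in A :|: B, and these are all its points. *)
Lemma johnson_triangle (A B C : {set X}) :
    #|C| = r.+1 -> #|A :&: B| = r -> #|A :&: C| = r -> #|B :&: C| = r ->
  ~~ (A :&: B \subset C) -> C \subset A :|: B.
Proof.
move=> cC cAB cAC cBC AB_C.
have lt_r : #|A :&: B :&: C| < r.
  rewrite -cAB; apply: proper_card; rewrite properE subsetIl /=.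
  by apply: contra AB_C => /subset_trans; apply; apply: subsetIr.
have := cardsUI (A :&: C) (B :&: C).
rewrite -setIUl setIACA setIid cAC cBC => cU.
apply/setIidPr/eqP; rewrite eqEcard subsetIr cC; lia.
Qed.

(** Either all members contain A :&: B, for some two members A and B, or all lie
in A :|: B by [johnson_triangle]; in the latter case there are at most r+2 of
them, as A :|: B has r+2 points. *)
Lemma johnson_clique (S : {set {set X}}) :
    (forall A, A \in S -> #|A| = r.+1) ->
    {in S &, forall A B, A != B -> #|A :&: B| = r} ->
    r.+2 < #|S| ->
  exists2 A : {set X}, #|A| = r & forall B, B \in S -> A \subset B.
Proof.
move=> cS cI ltS.
have /card_gt1P[A [B [AS BS AB]]] : 1 < #|S| by lia.
have [/forall_inP sub|] := boolP [forall C in S, A :&: B \subset C].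
  by exists (A :&: B); [apply: cI | move=> C /sub].
rewrite negb_forall_in => /exists_inP[C CS AB_C].
have neqC (Z : {set X}) : A :&: B \subset Z -> C != Z.
  by move=> sZ; apply: contraNneq AB_C => ->.
have AC : A != C by rewrite eq_sym neqC ?subsetIl.
have BC : B != C by rewrite eq_sym neqC ?subsetIr.
have sC : C \subset A :|: B.
  by apply: johnson_triangle AB_C; [apply: cS | apply: cI ..].
have cU (Y Z : {set X}) : Y \in S -> Z \in S -> Y != Z -> #|Y :|: Z| = r.+2.
  by move=> YS ZS YZ; have := cardsUI Y Z; rewrite (cI Y Z) // (cS Y) // (cS Z) //; lia.
have UE (Y : {set X}) : Y \in S -> Y != C -> Y \subset A :|: B -> Y :|: C = A :|: B.
  move=> YS YC sY; apply/eqP; rewrite eqEcard subUset sY sC.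
  by rewrite !cU ?leqnn.
have AUC := UE A AS AC (subsetUl _ _); have BUC := UE B BS BC (subsetUr _ _).
have sE (Z : {set X}) : Z \in S -> Z \subset A :|: B.
  move=> ZS; apply/negPn/negP => nZ.
  have neqZ (Y : {set X}) : Y \in S -> Y \subset A :|: B -> Y != Z.
    by move=> _ sY; apply: contraNneq nZ => <-.
  have A_Z := neqZ _ AS (subsetUl _ _); have B_Z := neqZ _ BS (subsetUr _ _).
  have C_Z := neqZ _ CS sC.
  (* Z would contain A :&: B and A :&: C, whose union is A. *)
  have sAB : A :&: B \subset Z.
    by apply: contraR nZ => /johnson_triangle; apply; [apply: cS | apply: cI ..].
  have sAC : A :&: C \subset Z.
    by apply: contraR nZ => /johnson_triangle; rewrite AUC; apply; [apply: cS | apply: cI ..].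
  have sAZ : A \subset Z.
    have <- : A :&: B :|: A :&: C = A by rewrite -setIUr BUC setUC setKU.
    by rewrite subUset sAB.
  by case/negP: A_Z; rewrite eqEcard sAZ !cS ?leqnn.
have : S \subset [set Z : {set X} | Z \subset A :|: B & #|Z| == r.+1].
  by apply/subsetP => Z ZS; rewrite inE sE //= cS.
by move/subset_leq_card; rewrite cards_draws cU // binSn; lia.
Qed.
End Cliques.

(** * Vertices as a side and a core, and stars *)

Section Stars.
Variables (V X : finType) (D : {set X}) (r : nat).
Variables (side : V -> bool) (core : V -> {set X}).
Hypothesis cardD : #|D| = r.*2 + 3.
Hypothesis coreL : forall v, core v \in layer D r.+1.
Hypothesis code_inj : forall u v, side u = side v -> core u = core v -> u = v.
Hypothesis code_surj : forall s A, A \in layer D r.+1 ->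
  exists2 v, side v = s & core v = A.

Definition johnson u v := (side u == side v) && (#|core u :&: core v| == r).

Definition star s (A : {set X}) := [set v | (side v == s) && (A \subset core v)].

Lemma core_sub v : core v \subset D.
Proof. by have := coreL v; rewrite inE => /andP[]. Qed.

Lemma card_core v : #|core v| = r.+1.
Proof. by have := coreL v; rewrite inE => /andP[_ /eqP]. Qed.

Lemma layerU1 A x : A \in layer D r -> x \in D :\: A -> x |: A \in layer D r.+1.
Proof.
rewrite !inE => /andP[AD /eqP cA] /andP[xA xD].
by rewrite subUset sub1set xD AD cardsU1 xA cA /=.
Qed.

Lemma layerD1 v x : x \in core v -> core v :\ x \in layer D r.
Proof.
move=> xv; rewrite inE (subset_trans (subsetDl _ _) (core_sub v)) /=.
by have := cardsD1 x (core v); rewrite xv card_core; lia.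
Qed.

Lemma card_star s A : A \in layer D r -> #|star s A| = r + 3.
Proof.
move=> AL; have := AL; rewrite inE => /andP[AD /eqP cA].
have -> : r + 3 = #|D :\: A| by rewrite cardsDS // cardD cA; lia.
have <- : #|core @: star s A| = #|star s A|.
  apply: card_in_imset => u v; rewrite !inE => /andP[/eqP su _] /andP[/eqP sv _].
  by apply: code_inj; rewrite su sv.
have <- : #|[set x |: A | x in D :\: A]| = #|D :\: A|.
  apply: card_in_imset => x y; rewrite !inE => /andP[xA _] _ E.
  have := setU11 x A; rewrite E !inE (negbTE xA) orbF.
  by move/eqP.
apply: eq_card => B; apply/imsetP/imsetP => [[v]|[x xA ->]].
  rewrite inE => /andP[_ Av] ->.
  have : #|core v :\: A| == 1 by rewrite cardsDS // card_core cA subSnn.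
  case/cards1P=> x E; have : x \in core v :\: A by rewrite E set11.
  rewrite inE => /andP[xA xv]; exists x; first by rewrite inE xA (subsetP (core_sub v)).
  by rewrite -(setID (core v) A) (setIidPr Av) E setUC.
have [v sv cv] := code_surj s (layerU1 AL xA).
by exists v => //; rewrite inE sv cv eqxx subsetUr.
Qed.

Lemma star_inj s t A B : A \in layer D r -> B \in layer D r ->
  star s A = star t B -> s = t /\ A = B.
Proof.
move=> AL BL E; have := AL; have := BL.
rewrite !inE => /andP[BD /eqP cB] /andP[AD /eqP cA].
have BU x : x \in D :\: A -> s = t /\ B \subset x |: A.
  move=> xA; have [v sv cv] := code_surj s (layerU1 AL xA).
  have : v \in star s A by rewrite inE sv cv eqxx subsetUr.
  by rewrite E inE sv cv => /andP[/eqP-> ->].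
have /card_gt1P[x [y [xA yA xy]]] : 1 < #|D :\: A|.
  by rewrite cardsDS // cardD cA; lia.
have [-> Bx] := BU x xA; have [_ By] := BU y yA; split=> //.
apply/esym/eqP; rewrite eqEcard cA cB leqnn andbT; apply/subsetP => z zB.
have := subsetP Bx z zB; have := subsetP By z zB; rewrite !inE.
by case: eqP => //= -> ; rewrite eq_sym (negbTE xy).
Qed.

Lemma star_johnson s A : A \in layer D r ->
  {in star s A &, forall u v, u != v -> johnson u v}.
Proof.
rewrite inE => /andP[_ /eqP cA] u v.
rewrite !inE => /andP[/eqP su Au] /andP[/eqP sv Av] uv.
rewrite /johnson su sv eqxx eqn_leq /=; apply/andP; split; last first.
  by rewrite -cA; apply: subset_leq_card; rewrite subsetI Au.
rewrite -ltnS -(card_core u); apply: proper_card; rewrite properE subsetIl /=.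
apply: contra uv => /subset_trans/(_ (subsetIr _ _)) suv; apply/eqP.
apply: code_inj; first by rewrite su.
by apply/eqP; rewrite eqEcard suv !card_core /=.
Qed.

(** This describes stars in terms of the relation [johnson] alone, so that they
are permuted by every bijection that preserves it. *)
Lemma johnson_clique_star (S : {set V}) :
    {in S &, forall u v, u != v -> johnson u v} -> #|S| = r + 3 ->
  exists s A, A \in layer D r /\ S = star s A.
Proof.
move=> SJ cS; have /card_gt0P[u uS] : 0 < #|S| by lia.
have sS v : v \in S -> side v = side u.
  move=> vS; have [-> //|vu] := eqVneq v u.
  by have /andP[/eqP] := SJ v u vS uS vu.
have [A cA subA] : exists2 A : {set X}, #|A| = r & forall B, B \in core @: S -> A \subset B.
  apply: johnson_clique => [B /imsetP[v _ ->]|B C|].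
  - exact: card_core.
  - case/imsetP=> v vS -> /imsetP[w wS ->] vw.
    have /andP[_ /eqP //] : johnson v w by apply: SJ => //; apply: contraNneq vw => ->.
  - rewrite card_in_imset ?cS; first by lia.
    by move=> v w vS wS; apply: code_inj; rewrite !sS.
have AL : A \in layer D r.
  rewrite inE cA eqxx andbT.
  exact: subset_trans (subA _ (imset_f core uS)) (core_sub u).
exists (side u), A; split=> //; apply/eqP; rewrite eqEcard card_star // cS leqnn.
rewrite andbT; apply/subsetP => v vS; rewrite inE sS // eqxx /=.
exact: subA (imset_f core vS).
Qed.

(** The common vertex is the one with core A :|: B. *)
Lemma star_meet s A B : A \in layer D r -> B \in layer D r ->
  #|A :|: B| = r.+1 -> exists v, star s A :&: star s B = [set v].
Proof.
rewrite !inE => /andP[AD _] /andP[BD _] cU.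
have [|v sv cv] := @code_surj s (A :|: B); first by rewrite inE subUset AD BD cU /=.
exists v; apply/setP => w; rewrite !inE.
apply/idP/eqP => [/andP[/andP[/eqP sw Aw] /andP[_ Bw]]|->]; last first.
  by rewrite sv cv eqxx subsetUl subsetUr.
apply: code_inj; first by rewrite sw.
by rewrite cv; apply/eqP; rewrite eq_sym eqEcard subUset Aw Bw cU card_core /=.
Qed.

Lemma mem_starP s A v : A \in layer D r ->
  reflect (s = side v /\ exists2 x, x \in core v & A = core v :\ x) (v \in star s A).
Proof.
rewrite 2!inE => /andP[_ /eqP cA].
apply: (iffP andP) => [[/eqP-> Av]|[-> [x _ ->]]]; last by rewrite eqxx subsetDl.
split=> //; have : #|core v :\: A| == 1 by rewrite cardsDS // card_core cA subSnn.
case/cards1P=> x E; have : x \in core v :\: A by rewrite E set11.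
rewrite inE => /andP[_ xv]; exists x => //.
by rewrite -E setDDr setDv set0U (setIidPr Av).
Qed.

(** A star through v is given by the point x of the core of v that it drops. *)
Lemma count_stars (P : pred {set V}) v :
    (forall S, P S -> exists s A, A \in layer D r /\ S = star s A) ->
  #|[set S | P S & v \in S]| = \sum_(x in core v) P (star (side v) (core v :\ x)).
Proof.
move=> Pstar.
transitivity #|[set star (side v) (core v :\ x)
                | x in [set x in core v | P (star (side v) (core v :\ x))]]|.
  apply: eq_card => S; rewrite inE.
  apply/andP/imsetP => [[PS]|[x]].
    have [s [A [AL ES]]] := Pstar S PS; rewrite ES => /(mem_starP _ _ AL)[Es [x xv EA]].
    by exists x; [rewrite inE xv -EA -Es -ES | rewrite Es EA].
  rewrite inE => /andP[xv PS] ->; split=> //.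
  by rewrite inE eqxx subsetDl.
rewrite card_in_imset => [|x y]; last first.
  rewrite !inE => /andP[xv _] /andP[yv _].
  case/(star_inj (layerD1 xv) (layerD1 yv)) => _ E.
  have := setD11 x (core v); rewrite E !inE xv andbT => /negbT.
  by rewrite negbK => /eqP.
rewrite -sum1_card (eq_bigl _ _ (in_set _)) big_mkcondr /=.
by apply: eq_bigr => x _; case: (P _).
Qed.
(** * No regular action preserves the Johnson relation *)

Section RegularAction.
Variables (gT : finGroupType) (to : {action gT &-> V}).
Hypothesis r_gt0 : 0 < r.
Hypothesis toJ : forall g u v, johnson u v -> johnson (to u g) (to v g).
Hypothesis to_trans : forall u v, exists g, to u g = v.
Hypothesis to_free : forall v g, to v g = v -> g = 1%g.

Lemma setact_star g s A : A \in layer D r ->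
  exists t B, B \in layer D r /\ (to^* (star s A) g)%act = star t B.
Proof.
move=> AL; apply: johnson_clique_star; last by rewrite card_setact card_star.
move=> _ _ /imsetP[u uS ->] /imsetP[v vS ->] uv.
apply: toJ; apply: star_johnson uS vS _ => //.
by apply: contraNneq uv => ->.
Qed.

Lemma count_orbit_transitive (S : {set V}) u v :
  #|[set T in orbit to^* [set: gT] S | u \in T]|
    = #|[set T in orbit to^* [set: gT] S | v \in T]|.
Proof.
have [g <-] := to_trans u v.
rewrite -(card_imset _ (act_inj (to^*)%act g)); apply: eq_card => T.
apply/imsetP/idP => [[W]|].
  rewrite inE => /andP[WO uW] ->.
  by rewrite inE orbit_actr ?inE // WO (mem_setact to g uW).
rewrite inE => /andP[TO vT]; exists (to^* T g^-1%g)%act; last by rewrite actKV.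
rewrite inE orbit_actr ?inE // TO.
by have := mem_setact to g^-1%g vT; rewrite actK.
Qed.

(** The same number c of stars of the orbit pass through each vertex, so the
function f, which is r+1 times the indicator of the orbit minus c, has zero sums
over the stars through a vertex and vanishes by [inclusion_injective].  Since
the orbit is not empty, c = r+1, and then every star is in the orbit. *)
Lemma star_orbit s A t B : A \in layer D r -> B \in layer D r ->
  star t B \in orbit to^* [set: gT] (star s A).
Proof.
move=> AL BL; set O := orbit _ _ _.
have Ostar T : T \in O -> exists s A, A \in layer D r /\ T = star s A.
  by case/imsetP=> g _ ->; apply: setact_star.
have /card_gt0P[v0 _] : 0 < #|star s A| by rewrite card_star // addn3.
pose c := #|[set T in O | v0 \in T]|.
pose f q C : int := (r.+1%:Z * (star q C \in O)%:Z - c%:Z)%R.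
have f0 q C : C \in layer D r -> f q C = 0%R.
  move=> CL; have r_pred := prednK r_gt0.
  apply: (@inclusion_injective _ D (f q) r.-1) => [|C'|]; rewrite r_pred //.
    by rewrite cardD; lia.
  move=> /(code_surj q)[v <- <-].
  rewrite /f GRing.sumrB -GRing.mulr_sumr GRing.sumr_const card_core.
  rewrite /c (count_orbit_transitive _ v0 v) (count_stars v Ostar).
  by rewrite (big_morph Posz PoszD erefl) -GRing.mulr_natl natz GRing.subrr.
have cE : c = r.+1.
  by have := f0 s A AL; rewrite /f orbit_refl; lia.
by have := f0 t B BL; rewrite /f cE; case: (_ \in O) => //; lia.
Qed.

(** Counting the pairs of a vertex and a star through it gives
r + 3 = h (r + 1), where h is the order of the stabiliser of a star; so r = 1
and h = 2, and the involution that stabilises a star fixes a vertex. *)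
Lemma johnson_not_regular : False.
Proof.
have [A0 A0L] : exists A0, A0 \in layer D r.
  by apply/card_gt0P; rewrite cards_draws bin_gt0 cardD; lia.
pose S0 := star true A0; pose O := orbit to^* [set: gT] S0.
pose H := ('C_[set: gT][S0 | to^*])%g.
have OH : #|O| * #|H| = #|V|.
  rewrite card_orbit_stab.
  have /card_gt0P[v0 _] : 0 < #|S0| by rewrite card_star // addn3.
  rewrite -(card_imset [set: gT] (f := to v0)); last first.
    move=> g h E; apply/eqP; rewrite eq_mulgV1; apply/eqP.
    by apply: (to_free (v := v0)); rewrite actM E actK.
  rewrite -cardsT; congr #|pred_of_set _|; apply/setP => v; rewrite !inE.
  by have [g <-] := to_trans v0 v; rewrite imset_f.
have Ostar T : T \in O -> exists s A, A \in layer D r /\ T = star s A.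
  by case/imsetP=> g _ ->; apply: setact_star.
have flags : #|O| * (r + 3) = #|V| * r.+1.
  transitivity (\sum_(T in O) #|T|).
    rewrite -sum_nat_const; apply: eq_bigr => T /Ostar[s [A [AL ->]]].
    by rewrite card_star.
  transitivity (\sum_(v : V) #|[set T in O | v \in T]|).
    under eq_bigr => T _ do rewrite -sum1_card big_mkcond.
    rewrite exchange_big; apply: eq_bigr => v _ /=.
    by rewrite -big_mkcondr sum1_card; apply: eq_card => T; rewrite inE.
  rewrite -sum_nat_const; apply: eq_bigr => v _.
  rewrite (count_stars v Ostar).
  transitivity (\sum_(x in core v) 1); last by rewrite sum1_card card_core.
  by apply: eq_bigr => x xv; rewrite star_orbit // layerD1.
have O_gt0 : 0 < #|O| by apply/card_gt0P; exists S0; apply: orbit_refl.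
have rH : r + 3 = #|H| * r.+1.
  by apply/eqP; rewrite -(eqn_pmul2l O_gt0) flags -OH mulnA.
have cH : #|H| = 2 by move: rH r_gt0; case: #|H| => [|[|[|h]]]; nia.
have r1 : r = 1 by lia.
have [g gH g1] : exists2 g, g \in H & g != 1%g.
  have /card_gt1P[g [h [gH hH gh]]] : 1 < #|H| by rewrite cH.
  have [g1|g1] := eqVneq g 1%g; last by exists g.
  by exists h; rewrite // -g1 eq_sym.
have gg : (g * g = 1)%g.
  by rewrite -expg2 -cH expg_cardG.
have S0g : (to^* S0 g)%act = S0 by move: gH; rewrite inE => /andP[_ /astab1P].
have not_fix1 v : (to^* [set v] g)%act <> [set v].
  rewrite /= /setact imset_set1 => /set1_inj /to_free g1E.
  by rewrite g1E eqxx in g1.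
have [A1 A1L A01] : exists2 A1, A1 \in layer D r & A1 != A0.
  have : 1 < #|layer D r| by rewrite cards_draws cardD r1 bin1.
  case/card_gt1P=> A [B [AL BL AB]].
  have [AA|AA] := eqVneq A A0; last by exists A.
  by exists B; rewrite // -AA eq_sym.
have meet s A B : A \in layer D r -> B \in layer D r -> A != B ->
    exists v, star s A :&: star s B = [set v].
  move=> AL BL AB; apply: star_meet => //.
  move: AL BL AB; rewrite !inE r1 => /andP[_ /cards1P[a ->]] /andP[_ /cards1P[b ->]].
  by rewrite cards2 => ab; rewrite (contraNneq _ ab) // => ->.
have setactI S T : (to^* (S :&: T) g = to^* S g :&: to^* T g)%act.
  exact: imsetI (in2W (act_inj to g)).
(* The image of the star of A1 has the same side, as it meets that of A0. *)
have [s [A2 [A2L T2]]] := setact_star g true A1L.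
have [v Ev] : exists v, star true A0 :&: star true A1 = [set v].
  by apply: meet; rewrite // eq_sym.
have sT : s = true.
  have : to v g \in star s A2.
    by rewrite -T2 mem_setact //; have := set11 v; rewrite -Ev inE => /andP[].
  rewrite inE => /andP[/eqP<- _].
  have : to v g \in S0.
    by rewrite -S0g mem_setact //; have := set11 v; rewrite -Ev inE => /andP[].
  by rewrite inE => /andP[/eqP->].
rewrite {}sT in T2.
have [E|A12] := eqVneq A1 A2.
  by apply: (not_fix1 v); rewrite -Ev setactI S0g T2 -E.
(* The stars of A1 and A2 are exchanged by the involution. *)
have [w Ew] := meet true _ _ A1L A2L A12.
by apply: (not_fix1 w); rewrite -Ew setactI T2 -T2 -actM gg act1 setIC.
Qed.
End RegularAction.
(** * Pairs of vertices with exactly one common neighbour *)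

Section CommonNeighbour.
Variables (b : bool) (e : rel V).
Hypothesis r_gt0 : 0 < r.
Hypothesis eE : forall u v, e u v = (side u != side v) &&
  ([disjoint core u & core v] || b && (core u == core v)).

(** Common neighbours exist only for vertices of the same side.  Those with core
disjoint from both cores correspond to the (r+1)-sets in the complement of
their union, which has one point more than their intersection: there is one if
the intersection has r points, and none if it is smaller.  Any other common
neighbour has the core of u or of v (this needs b); then the two cores are
disjoint, and both choices give a common neighbour. *)
Lemma johnson_common_neighbour u v : u != v ->
  johnson u v <-> exists w, forall z, e u z && e v z = (z == w).
Proof.
move=> uv; have cU := cardsUI (core u) (core v); rewrite !card_core in cU.
have UD : core u :|: core v \subset D by rewrite subUset !core_sub.
have cW : #|D :\: (core u :|: core v)| = (#|core u :&: core v|).+1.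
  by have := subset_leq_card UD; rewrite cardsDS // cardD; lia.
have sub_disj w : [disjoint core u & core w] -> [disjoint core v & core w] ->
    core w \subset D :\: (core u :|: core v).
  move=> uw vw; rewrite subsetD core_sub -setI_eq0 setIUr setU_eq0 !setI_eq0.
  by rewrite ![[disjoint core w & _]]disjoint_sym uw.
have cores_neq : side u = side v -> core u != core v.
  by move=> suv; apply: contra uv => /eqP/(code_inj suv)->.
split=> [/andP[/eqP suv /eqP cI]|[w wP]].
  have [|w sw cw] := @code_surj (~~ side u) (D :\: (core u :|: core v)).
    by rewrite inE subsetDl cW cI /=.
  exists w => z; apply/idP/eqP => [|->]; last first.
    have dW (B : {set X}) : B \subset core u :|: core v -> [disjoint B & core w].
      by move=> BU; rewrite cw disjoints_subset setCD (subset_trans BU) ?subsetUr.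
    by rewrite !eE -suv sw !dW ?subsetUl ?subsetUr //; case: (side u).
  rewrite !eE -suv => /andP[/andP[sz uz] /andP[_ vz]].
  have uv_meet : ~~ [disjoint core u & core v].
    by rewrite -setI_eq0 -cards_eq0 cI -lt0n.
  have uz' : [disjoint core u & core z].
    case/orP: uz => // /andP[_ /eqP E]; case/orP: vz; rewrite -E.
      by rewrite disjoint_sym (negbTE uv_meet).
    by rewrite eq_sym (negbTE (cores_neq suv)) andbF.
  have vz' : [disjoint core v & core z].
    case/orP: vz => // /andP[_ /eqP E]; case/orP: uz; rewrite -E.
      by rewrite (negbTE uv_meet).
    by rewrite (negbTE (cores_neq suv)) andbF.
  apply: code_inj; first by rewrite sw; case: (side u) (side z) sz => [] [].
  by rewrite cw; apply/eqP; rewrite eqEcard sub_disj //= cW cI card_core.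
have /andP[] : e u w && e v w by rewrite wP.
rewrite !eE => /andP[suw uw] /andP[svw vw].
have suv : side u = side v by case: (side u) (side v) (side w) suw svw => [] [] [].
have cuv := cores_neq suv.
(* A common neighbour with the core of u comes with one with the core of v. *)
have antipode : b -> [disjoint core u & core v] -> False.
  move=> bT duv; have [u' su' cu'] := code_surj (side w) (coreL u).
  have [v' sv' cv'] := code_surj (side w) (coreL v).
  have /eqP Eu : u' == w.
    by rewrite -wP !eE su' cu' suw svw bT eqxx orbT disjoint_sym duv.
  have /eqP Ev : v' == w.
    by rewrite -wP !eE sv' cv' suw svw bT eqxx orbT duv.
  by case/eqP: cuv; rewrite -cu' -cv' Eu Ev.
rewrite /johnson suv eqxx eqn_leq /=; apply/andP; split.
  rewrite -ltnS -(card_core u); apply: proper_card; rewrite properE subsetIl /=.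
  apply: contra cuv => /subset_trans/(_ (subsetIr _ _)) sub.
  by rewrite eqEcard sub !card_core leqnn.
suff : core w \subset D :\: (core u :|: core v).
  by move/subset_leq_card; rewrite cW card_core.
apply: sub_disj; apply/negPn/negP => /negbTE nd.
  move: uw; rewrite nd /= => /andP[bT /eqP E]; apply: antipode => //.
  by move: vw; rewrite -E eq_sym (negbTE cuv) andbF orbF disjoint_sym.
move: vw; rewrite nd /= => /andP[bT /eqP E]; apply: antipode => //.
by move: uw; rewrite -E (negbTE cuv) andbF orbF.
Qed.
End CommonNeighbour.
End Stars.

(** * Hyper-star graphs in terms of sides and cores *)

Section HyperStar.
Variable k : nat.
Hypothesis k_ge3 : 3 <= k.

Lemma double_k_gt0 : 0 < 2 * k. Proof. lia. Qed.
Definition one : 'I_(2 * k) := Ordinal double_k_gt0.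

(** This is v without 1 if 1 is in v, and the complement of v without 1
otherwise. *)
Definition hs_core (v : ksubset k) : {set 'I_(2 * k)} :=
  [set x | (x != one) && ((x \in val v) == has_one v)].

Lemma has_oneE v : has_one v = (one \in val v).
Proof.
apply/exists_inP/idP => [[i iv /eqP i0]|v1]; last by exists one.
by rewrite (_ : one = i) //; apply: val_inj.
Qed.

Lemma card_setC_one : #|~: [set one]| = (k - 2).*2 + 3.
Proof. by have := cardsC [set one]; rewrite cards1 card_ord; lia. Qed.

Lemma hs_core_in (v : ksubset k) : has_one v -> hs_core v = val v :\ one.
Proof. by move=> v1; apply/setP => x; rewrite !inE v1 eqb_id. Qed.

Lemma hs_core_out (v : ksubset k) : ~~ has_one v -> hs_core v = ~: [set one] :\: val v.
Proof. by move=> v1; apply/setP => x; rewrite !inE (negbTE v1) eqbF_neg andbC. Qed.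

Lemma hs_core_layer v : hs_core v \in layer (~: [set one]) (k - 2).+1.
Proof.
rewrite inE; apply/andP; split; first by apply/subsetP => x; rewrite !inE => /andP[].
have [v1|v1] := boolP (has_one v).
  rewrite hs_core_in //; have := cardsD1 one (val v).
  rewrite -has_oneE v1 (eqP (valP v)) add1n => E.
  by rewrite -eqSS -E; lia.
rewrite hs_core_out // cardsDS ?card_setC_one ?(eqP (valP v)); first by lia.
by rewrite subsetC sub1set inE -has_oneE.
Qed.

Lemma hs_code_inj u v : has_one u = has_one v -> hs_core u = hs_core v -> u = v.
Proof.
move=> suv /setP E; apply/val_inj/setP => x.
have [->|x1] := eqVneq x one; first by rewrite -!has_oneE.
have := E x; rewrite !inE x1 suv /=.
by case: (x \in val u) (x \in val v) (has_one v) => [] [] [].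
Qed.

Lemma hs_code_surj s A : A \in layer (~: [set one]) (k - 2).+1 ->
  exists2 v : ksubset k, has_one v = s & hs_core v = A.
Proof.
rewrite inE subsetC sub1set inE => /andP[A1 /eqP cA].
pose S := [set x | (x \in one |: A) == s].
have cU : #|one |: A| = k by rewrite cardsU1 A1 cA; lia.
have cS : #|S| == k.
  rewrite /S; case: (s).
    by rewrite (_ : [set x | _] = one |: A) ?cU //; apply/setP => x; rewrite inE eqb_id.
  rewrite (_ : [set x | _] = ~: (one |: A)); last by apply/setP => x; rewrite !inE eqbF_neg.
  by have := cardsC (one |: A); rewrite cU card_ord; lia.
pose v : ksubset k := exist _ S cS.
have sv : has_one v = s by rewrite has_oneE !inE eqxx; case: (s).
exists v => //; apply/setP => x; rewrite !inE sv.
have [->|x1] /= := eqVneq x one; first by rewrite (negbTE A1).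
by case: (_ \in _) (s) => [] [].
Qed.

(** If 1 is in v and not in w, then v :&: w is the part of the core of v outside
the core of w; it has k-1 points exactly when it is the whole core of v. *)
Lemma HS_core v w :
  HS v w = (has_one v != has_one w) && [disjoint hs_core v & hs_core w].
Proof.
wlog v1 : v w / has_one v.
  move=> H; have [v1|v1] := boolP (has_one v); first by rewrite H // v1.
  have [w1|w1] := boolP (has_one w).
    by rewrite HS_sym disjoint_sym H // w1 (negbTE v1).
  by rewrite /HS (negbTE v1) (negbTE w1) andbF.
rewrite /HS v1 andbC; case: (boolP (has_one w)) => //= w1.
have cv : #|hs_core v| = k.-1.
  by have := hs_core_layer v; rewrite inE => /andP[_ /eqP->]; lia.
have -> : val v :&: val w = hs_core v :\: hs_core w.
  apply/setP => x; rewrite !inE v1 (negbTE w1) eqb_id eqbF_neg.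
  have [->|] := eqVneq x one; first by rewrite -!has_oneE (negbTE w1) andbF.
  by rewrite negbK andbC.
by rewrite -cv; apply/eqP/setDidPl => [cD|-> //]; apply/eqP; rewrite eqEcard subsetDl cD /=.
Qed.

Lemma complement_core v w : (val w == ~: val v)
  = (has_one v != has_one w) && (hs_core v == hs_core w).
Proof.
apply/eqP/andP => [E|[sd /eqP E]].
  have sw : has_one w = ~~ has_one v by rewrite !has_oneE E inE.
  split; first by rewrite sw; case: has_one.
  apply/eqP/setP => x; rewrite !inE sw E inE.
  by case: (x \in val v) (has_one v) => [] [].
apply/setP => x; rewrite inE; have [->|x1] := eqVneq x one.
  by rewrite -!has_oneE; case: (has_one v) (has_one w) sd => [] [].
have /setP/(_ x) := E; rewrite !inE x1 /=.
by case: (has_one v) (has_one w) (x \in val v) (x \in val w) sd => [] [] [] [].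
Qed.
End HyperStar.

Theorem theorem3p2 (k : nat) (k_ge3 : 3 <= k) (Gamma : rel (ksubset k))
    (GammaE : Gamma = @HS k \/ Gamma = @FHS k) :
  ~ is_cayley_graph Gamma.
Proof.
case=> gT [Omega [_ [phi phi_bij phiE]]].
have [psi phiK psiK] := phi_bij.
have [b Gcore] : exists b, forall v w, Gamma v w = (has_one v != has_one w) &&
    ([disjoint hs_core k_ge3 v & hs_core k_ge3 w]
      || b && (hs_core k_ge3 v == hs_core k_ge3 w)).
  case: GammaE => ->; [exists false | exists true] => v w.
    by rewrite orbF HS_core.
  by rewrite /FHS (HS_core k_ge3) (complement_core k_ge3) -andb_orr.
(* Left translations by inverses, as actions are written on the right. *)
pose mul v g := psi (g^-1 * phi v)%g.
have mul1 v : mul v 1%g = v by rewrite /mul invg1 mul1g phiK.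
have mulM v : act_morph mul v.
  by move=> g h; rewrite /mul psiK invMg mulgA.
pose to := TotalAction mul1 mulM.
have GammaM g u v : Gamma (to u g) (to v g) = Gamma u v.
  by rewrite -!phiE /= /mul !psiK /cayley invMg invgK -mulgA mulKVg.
have commonM g u v : (exists w, forall z, Gamma u z && Gamma v z = (z == w)) ->
    exists w, forall z, Gamma (to u g) z && Gamma (to v g) z = (z == w).
  case=> w wP; exists (to w g) => z; rewrite -(actKV to g z) !GammaM wP.
  by rewrite (inj_eq (act_inj to g)).
have r_gt0 : 0 < k - 2 by lia.
have cn := johnson_common_neighbour (card_setC_one k_ge3) (hs_core_layer k_ge3)
  (@hs_code_inj k k_ge3) (@hs_code_surj k k_ge3) r_gt0 Gcore.
apply: (johnson_not_regular (to := to) (card_setC_one k_ge3) (hs_core_layer k_ge3)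
  (@hs_code_inj k k_ge3) (@hs_code_surj k k_ge3)) => //.
- move=> g u v uvJ; have uv : u != v.
    apply: contraTneq uvJ => ->; rewrite /johnson setIid.
    by have := hs_core_layer k_ge3 v; rewrite inE => /andP[_ /eqP->]; lia.
  apply/cn; first by rewrite (inj_eq (act_inj to g)).
  by apply: commonM; apply/cn.
- move=> u v; exists (phi u * (phi v)^-1)%g.
  by rewrite /= /mul invMg invgK mulgKV phiK.
- move=> v g /(congr1 phi); rewrite /= /mul psiK => /(canRL (mulgK _)).
  by rewrite mulgV => /eqP; rewrite invg_eq1 => /eqP.
Qed.
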